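(* Let $T:V\to A$ be a relative Rota-Baxter operator on a Jacobi-Jordan algebra $(A,\ast)$ with respect to a representation $(V,\rho)$. If two linear deformations $T_t^1=T+tJ_1$ and $T_t^2=T+tJ_2$ of $T$ are equivalent, then $J_1$ and $J_2$ are in the same cohomology class, i.e. $J_2-J_1\in B^1(V,A)$.
   Context: All vector spaces are finite dimensional over a field $\mathbb{K}$ of characteristic $0$; an algebra is a vector space with a bilinear product, not assumed associative. A Jacobi-Jordan algebra is an algebra $(A,\ast)$ with $x\ast y=y\ast x$ and $(x\ast y)\ast z+(y\ast z)\ast x+(z\ast x)\ast y=0$ for all $x,y,z$. A representation of $(A,\ast)$ is a pair $(V,\rho)$ with $\rho:A\to gl(V)$ linear such that $\rho(x\ast y)=-\rho(x)\rho(y)-\rho(y)\rho(x)$. A linear map $T:V\to A$ is a relative Rota-Baxter operator with respect to $(V,\rho)$ if $T(u)\ast T(v)=T(\rho(T(u))v+\rho(T(v))u)$ for all $u,v\in V$. A linear deformation of $T$ is a family $T_t=T+tJ$ with $J:V\to A$ linear such that $T_t$ is a relative Rota-Baxter operator with respect to $(V,\rho)$ for all $t\in\mathbb{K}$. A morphism from a relative Rota-Baxter operator $T'$ to a relative Rota-Baxter operator $T$ (both with respect to $(V,\rho)$) is a pair $(\phi_A,\phi_V)$ with $\phi_A:A\to A$ a Jacobi-Jordan algebra morphism and $\phi_V:V\to V$ linear such that $T\circ\phi_V=\phi_A\circ T'$ and $\phi_V\circ\rho(x)=\rho(\phi_A(x))\circ\phi_V$ for all $x\in A$. Write $L_x(y)=x\ast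 y$. Two linear deformations $T_t^1=T+tJ_1$, $T_t^2=T+tJ_2$ are equivalent if there exists $x\in C^0(V,A)=A$ such that, for all $t\in\mathbb{K}$, $(Id_A+tL_x,Id_V+t\rho(x))$ is a morphism from $T_t^2$ to $T_t^1$. Cohomology: for $v\in V$, $x\in A$ put $\rho_T(v)x:=T(v)\ast x-T(\rho(x)v)$. The degree-zero differential $\delta^0_{\rho_T}:A\to \mathrm{Hom}(V,A)$ is $\delta^0_{\rho_T}(x)(v):=\rho_T(v)x$, and $B^1(V,A)$ denotes its image (the $1$-coboundaries). Two linear maps $V\to A$ are in the same cohomology class if their difference lies in $B^1(V,A)$. *)

(* Defs.v *)
From HB Require Import structures.
From mathcomp Require Import all_boot all_order all_algebra.
Set Implicit Arguments.
Unset Strict Implicit.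
Unset Printing Implicit Defensive.
Import GRing.Theory.
Local Open Scope ring_scope.

Section JacobiJordan.
Variables (K : fieldType) (A : vectType K) (mul : {bilinear A -> A -> A}).
Local Notation "x ** y" := (mul x y) (at level 40, left associativity).

Definition is_jacobi_jordan : Prop :=
  (forall x y, x ** y = y ** x) /\
  (forall x y z, (x ** y) ** z + (y ** z) ** x + (z ** x) ** y = 0).

Definition is_algebra_morphism (phi : 'End(A)) : Prop :=
  forall x y, phi (x ** y) = phi x ** phi y.

Definition lmul (x : A) : 'End(A) := linfun (mul x).

Lemma lmulE x y : lmul x y = x ** y.
Proof. by rewrite /lmul lfunE. Qed.

Section Representation.
Variables (V : vectType K) (rho : {linear A -> 'End(V)}).

Definition is_representation : Prop :=
  forall x y, rho (x ** y) = - (rho x \o rho y)%VF - (rho y \o rho x)%VF.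

Definition is_rel_rota_baxter (T : 'Hom(V, A)) : Prop :=
  forall u v, T u ** T v = T (rho (T u) v + rho (T v) u).

Definition is_linear_deformation (T J : 'Hom(V, A)) : Prop :=
  forall t : K, is_rel_rota_baxter (T + t *: J).

(* Morphisms go from T' to T. *)
Definition is_rrb_morphism (T' T : 'Hom(V, A))
    (phiA : 'End(A)) (phiV : 'End(V)) : Prop :=
  [/\ is_algebra_morphism phiA,
      (T \o phiV)%VF = (phiA \o T')%VF
    & forall x, (phiV \o rho x)%VF = (rho (phiA x) \o phiV)%VF].

Definition equivalent_deformations (T J1 J2 : 'Hom(V, A)) : Prop :=
  exists x : A, forall t : K,
    is_rrb_morphism (T + t *: J2) (T + t *: J1)
      (\1%VF + t *: lmul x) (\1%VF + t *: rho x).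

Section Cohomology.
Variable T : 'Hom(V, A).

Definition rhoT (v : V) (x : A) : A := T v ** x - T (rho x v).

Definition delta0_fun (x : A) (v : V) : A := rhoT v x.

Fact delta0_fun_linear x : linear (delta0_fun x).
Proof.
move=> a u v; rewrite /delta0_fun /rhoT (linearP T) linearPl (linearP (rho x)).
by rewrite (linearP T) /= scalerBr opprD addrACA.
Qed.

Fact rhoT_linearr v : linear (rhoT v).
Proof.
move=> a x y; rewrite /rhoT linearPr (linearP rho) add_lfunE scale_lfunE.
by rewrite (linearP T) /= scalerBr opprD addrACA.
Qed.

HB.instance Definition _ x := GRing.isLinear.Build K V A *:%R (delta0_fun x)
  (delta0_fun_linear x).

Definition delta0 (x : A) : 'Hom(V, A) := linfun (delta0_fun x).

Lemma delta0E x v : delta0 x v = rhoT v x.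
Proof. by rewrite /delta0 lfunE. Qed.

Fact delta0_linear : linear delta0.
Proof.
move=> a x y; apply/lfunP => v.
by rewrite add_lfunE scale_lfunE !delta0E rhoT_linearr.
Qed.

HB.instance Definition _ := GRing.isLinear.Build K A 'Hom(V, A) *:%R delta0
  delta0_linear.

Definition B1 : {vspace 'Hom(V, A)} := limg (linfun delta0).

Lemma B1P J : reflect (exists x, J = delta0 x) (J \in B1).
Proof.
apply: (iffP memv_imgP) => [[x _ ->]|[x ->]]; exists x; rewrite ?lfunE //.
exact: memvf.
Qed.

Definition same_cohomology_class (J1 J2 : 'Hom(V, A)) : Prop := J2 - J1 \in B1.

End Cohomology.
End Representation.
End JacobiJordan.

(* Main.v *)
(* Comparing the coefficients of t in T_t^1 (Id + t rho x) = (Id + t L_x) T_t^2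
   gives J_2 - J_1 = T rho(x) - L_x T, which is the coboundary of -x. As the
   identity is quadratic in t with no constant term, t = 1 and t = -1 suffice to
   isolate that coefficient in characteristic different from 2. *)
Require Import Defs.
From mathcomp Require Import all_boot all_order all_algebra.
Import GRing.Theory.
Local Open Scope ring_scope.

(** The values at [1] and [-1] give [a = - b] and [b = a], hence [2a = 0]. *)
Lemma quadratic_coef1_eq0 (K : fieldType) (W : lmodType K) (a b : W) :
  2%:R != 0 :> K ->
  (forall t : K, t *: a + (t * t) *: b = 0) -> a = 0.
Proof.
move=> two_neq0 ab0.
have /eqP := ab0 1; rewrite mulr1 !scale1r addr_eq0 => /eqP a_eq.
have /eqP := ab0 (-1); rewrite mulrNN mulr1 scaleN1r scale1r addrC subr_eq0.
move=> /eqP b_eq; move: a_eq; rewrite b_eq => /eqP.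
by rewrite -addr_eq0 -mulr2n -scaler_nat scaler_eq0 (negPf two_neq0) => /eqP.
Qed.

(** At [v] both sides have constant term [T v], so their difference has only terms of degree 1 and 2
    in [t]. *)
Lemma equivalence_quadratic (K : fieldType) (A V : vectType K)
    (mul : {bilinear A -> A -> A}) (rho : {linear A -> 'End(V)})
    (T J1 J2 : 'Hom(V, A)) (x : A) (t : K) (v : V) :
  ((T + t *: J1) \o (\1 + t *: rho x))%VF =
    ((\1 + t *: lmul mul x) \o (T + t *: J2))%VF ->
  t *: (J1 v + T (rho x v) - (J2 v + mul x (T v)))
    + (t * t) *: (J1 (rho x v) - mul x (J2 v)) = 0.
Proof.
move=> /lfunP/(_ v).
rewrite !(comp_lfunE, add_lfunE, scale_lfunE, id_lfunE, lmulE, linearD, linearZ).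
rewrite /= => /eqP; rewrite -subr_eq0 => /eqP <-.
rewrite !(scalerDr, scalerN, opprD, scalerA).
(* The right-hand side is now the expanded difference, four terms from each composite; terms 1 and 5
   are [T v] and [- T v], and the others are grouped by degree in [t]. *)
by rewrite [RHS](AC ((2*2)*(2*2)) (1*5*((3*2)*(6*7)*(4*8)))) /= subrr add0r.
Qed.

Theorem theorem3p13 (K : fieldType) (char0 : [pchar K] =i pred0)
    (A V : vectType K) (mul : {bilinear A -> A -> A})
    (rho : {linear A -> 'End(V)}) (T J1 J2 : 'Hom(V, A)) :
  is_jacobi_jordan mul ->
  is_representation mul rho ->
  is_rel_rota_baxter mul rho T ->
  is_linear_deformation mul rho T J1 ->
  is_linear_deformation mul rho T J2 ->
  equivalent_deformations mul rho T J1 J2 ->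
  same_cohomology_class mul rho T J1 J2.
Proof.
move=> [mulC _] _ _ _ _ [x equivx].
have two_neq0 : 2%:R != 0 :> K by rewrite ((pcharf0P K).1 char0).
apply/B1P; exists (- x); apply/lfunP => v.
rewrite linearN !opp_lfunE add_lfunE opp_lfunE delta0E /rhoT.
have /eqP : J1 v + T (rho x v) - (J2 v + mul x (T v)) = 0.
  apply: (quadratic_coef1_eq0 _ _ _ _ two_neq0) => t.
  by apply: equivalence_quadratic; case: (equivx t).
(* Commutativity turns [mul x (T v)], which comes from [lmul], into the product [mul (T v) x] of
   [rhoT]. *)
rewrite subr_eq0 (mulC x) opprB => /eqP J1_eq; apply/eqP.
by rewrite subr_eq addrAC eq_sym subr_eq addrC J1_eq.
Qed.
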